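(* For any $p\in\mathbb{N}$, $p\geq 1$, there exists $\widetilde{\rho}_p>0$ such that, for every $\rho>\widetilde{\rho}_p$ (independent of $n$), the family of matrices $\{\widetilde{\mathbf{W}}_n^p(\rho)\}_n$ is not weakly well-conditioned.
   Context: Fix $T>0$. For $N\in\mathbb{N}$ let $h=T/N$, and for $p\ge 1$ let $\{\varphi_j^p\}_{j=0}^{N+p-1}$ be the B-spline basis (Cox–de Boor) of degree $p$ and maximal regularity $C^{p-1}$ on the uniform mesh of $[0,T]$ with $N$ intervals, with open knot vector (the end points are repeated $p+1$ times, the interior knots are simple). Throughout $N\ge 3p+1$. For $\ell,j=1,\ldots,N+p-1$ let $\mathbf{C}_h^p[\ell,j]=\int_0^T\partial_t\varphi_j^p\,\varphi_{\ell-1}^p\,dt$ and $\mathbf{M}_h^p[\ell,j]=\int_0^T\varphi_j^p\,\varphi_{\ell-1}^p\,dt$. With $n=N+p-1$ set $\mathbf{C}_n^p=\mathbf{C}_h^p$, $\mathbf{M}_n^p=\frac1h\mathbf{M}_h^p$, and for $\rho>0$ $$\mathbf{W}_n^p(\rho):=\rho(\mathbf{M}_n^p)^2+(\mathbf{C}_n^p)^2.$$ Except for top left and bottom right corner blocks of size independent of $n$, the matrices $\mathbf{M}_n^p,\mathbf{C}_n^p$, hence also $\mathbf{W}_n^p(\rho)$, are Toeplitz band matrices; $\widetilde{\mathbf{W}}_n^p(\rho)$ denotes the $n\times n$ Toeplitz band matrix that extends the purely Toeplitz part of $\mathbf{W}_n^p(\rho)$ to the full $n\times n$ size. Explicitly,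 let $\Phi_k$ be the cardinal spline of degree $k$ (the B-spline of degree $k$, regularity $C^{k-1}$, on the knots $\{0,1,\ldots,k+1\}$, normalized so that $\Phi_0=\chi_{[0,1)}$ and $\Phi_k(t)=\int_0^1\Phi_{k-1}(t-s)\,ds$). In the purely Toeplitz part, for $j=0,\ldots,p$, $\mathbf{M}_n^p[\ell,\ell-1\pm j]=\Phi_{2p+1}(p+1-j)$ and $\mathbf{C}_n^p[\ell,\ell-1\pm j]=\pm\partial_t\Phi_{2p+1}(p+1-j)$ if $j\neq0$, $\mathbf{C}_n^p[\ell,\ell-1]=0$, all other entries being zero. With $q^{\mathbf{M}^p}(z)=\Phi_{2p+1}(p+1)z^p+\sum_{j=1}^p\Phi_{2p+1}(p+1-j)(z^{p+j}+z^{p-j})$ and $q^{\mathbf{C}^p}(z)=\sum_{j=1}^p\partial_t\Phi_{2p+1}(p+1-j)(z^{p+j}-z^{p-j})$, the entry of $\widetilde{\mathbf{W}}_n^p(\rho)$ at position $[r,s]$ is the coefficient of $z^{2p+2+s-r}$ in $\rho\,q^{\mathbf{M}^p}(z)^2+q^{\mathbf{C}^p}(z)^2$ (zero if $2p+2+s-r\notin\{0,\ldots,4p\}$). A family of matrices $\{\mathbf{A}_n\}_n$, $\mathbf{A}_n\in\mathbb{R}^{n\times n}$, is weakly well-conditioned if, for $n$ sufficiently large, the matrices $\mathbf{A}_n$ are invertible and their condition numbers grow only algebraically in $n$, i.e. $\kappa(\mathbf{A}_n)=\mathcal{O}(n^{\alpha})$ for some $\alpha\ge0$ (independently of which of the norms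 $\|\cdot\|_1,\|\cdot\|_2,\|\cdot\|_\infty$ is used). *)

(* Defs.v *)
From HB Require Import structures.
From mathcomp Require Import all_boot all_order all_algebra.
From mathcomp Require Import all_classical all_reals all_analysis.
Set Implicit Arguments.
Unset Strict Implicit.
Unset Printing Implicit Defensive.
Import Order.TTheory GRing.Theory Num.Theory.
Import numFieldNormedType.Exports.
Local Open Scope classical_set_scope.
Local Open Scope ring_scope.

Fixpoint cardinal_spline (R : realType) (k : nat) (t : R) : R :=
  if k is k'.+1 then
    Rintegral lebesgue_measure `[0, 1] (fun s : R => cardinal_spline k' (t - s))
  else \1_(`[0, 1[) t.

(* Here and in [qC], the subtractions [p.+1 - j] and [p - j] are on [nat] and
   never truncated, since j <= p. *)
Definition qM (R : realType) (p : nat) : {poly R} :=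
  cardinal_spline (2 * p).+1 (p.+1%:R : R) *: 'X^p +
  \sum_(1 <= j < p.+1)
     cardinal_spline (2 * p).+1 ((p.+1 - j)%:R : R) *: ('X^(p + j) + 'X^(p - j)).

Definition qC (R : realType) (p : nat) : {poly R} :=
  \sum_(1 <= j < p.+1)
     (derive1 (cardinal_spline (R := R) (2 * p).+1) (p.+1 - j)%:R : R) *:
       ('X^(p + j) - 'X^(p - j)).

(* The row and column indices are 0-based, which does not affect s - r. The
   polynomial has degree at most 4p, so its coefficients vanish beyond that;
   the test excludes the negative exponents 2p + 2 + s - r. The main diagonal
   carries the coefficient of 'X^(2p + 2) rather than the central one, because
   the mass and advection matrices pair trial function l with test function
   l - 1. *)
Definition Wtilde (R : realType) (p : nat) (rho : R) (n : nat) : 'M[R]_n :=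
  \matrix_(r < n, s < n)
    if (r <= 2 * p + 2 + s)%N
    then (rho *: qM R p ^+ 2 + qC R p ^+ 2)`_(2 * p + 2 + s - r)
    else 0.

Inductive norm_index := norm1 | norm2 | norm_infty.

Definition vec_norm (R : realType) (nu : norm_index) (n : nat) (x : 'cV[R]_n) : R :=
  match nu with
  | norm1 => \sum_(i < n) `|x i 0|
  | norm2 => Num.sqrt (\sum_(i < n) `|x i 0| ^+ 2)
  | norm_infty => \big[Num.max/0]_(i < n) `|x i 0|
  end.

Definition op_norm (R : realType) (nu : norm_index) (n : nat) (A : 'M[R]_n) : R :=
  sup [set vec_norm nu (A *m x) | x in [set x : 'cV[R]_n | vec_norm nu x <= 1]].

(* Meaningful for A \in unitmx only: otherwise [invmx A] is A. *)
Definition condition_number (R : realType) (nu : norm_index) (n : nat)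
    (A : 'M[R]_n) : R :=
  op_norm nu A * op_norm nu (invmx A).

Definition weakly_well_conditioned (R : realType) (nu : norm_index)
    (A : forall n, 'M[R]_n) : Prop :=
  (\forall n \near \oo, A n \in unitmx) /\
  exists2 alpha : R, 0 <= alpha &
    (fun n => condition_number nu (A n) : R^o) =O_\oo
      (fun n => n%:R `^ alpha : R^o).

(* Main.v *)
Require Import Defs.
From HB Require Import structures.
From mathcomp Require Import all_boot all_order all_algebra.
From mathcomp Require Import all_classical all_reals all_analysis.
From mathcomp Require Import ring lra zify.
Import Order.TTheory GRing.Theory Num.Theory.
Import numFieldNormedType.Exports.
Local Open Scope classical_set_scope.
Local Open Scope ring_scope.

(** Let T be the semi-infinite Toeplitz operator whose symbol is
    rho * qM ^ 2 + qC ^ 2 divided by X ^ 2p, that is, with the central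
    coefficient of this polynomial on the main diagonal. On the unit circle
    qM / X ^ p is real and qC / X ^ p is imaginary, so the symbol is
    rho * |qM| ^ 2 - |qC| ^ 2; since qM does not vanish on the circle, the
    symbol is bounded below by a positive constant once rho is large, and T is
    coercive. The matrix [Wtilde p rho n] is a section of T moved by two
    diagonals, so its symbol winds around the origin, which is what ruins the
    conditioning. Concretely, if x is y written backwards, then
    [Wtilde p rho n *m x] lists backwards the n entries of T y that follow the
    first two. A vector y of length n for which T y is close to the first unit vector
    thus gives an x of size of order 1 with a tiny image. The Richardson
    iteration y := y + (e0 - b T y) produces it: it converges geometrically
    because T is coercive and bounded, and the support of y grows only linearly
    with the number of steps because T is banded, so that the residual is
    exponentially small in n ([toeplitz_richardson]). Hence the condition number
    grows exponentially in n
    ([shifted_toeplitz_not_weakly_well_conditioned]).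

    No Fourier analysis is used. Finitely supported sequences are polynomials
    with the scalar product [coef_dot] of their coefficients, convolution is the
    product of polynomials, and symbol estimates become estimates of quadratic
    forms. The palindromic qM is self-adjoint and the antipalindromic qC is
    skew-adjoint up to a shift, which yields rho * |qM g| ^ 2 - |qC g| ^ 2 as the
    quadratic form of T ([Wtilde_coercive]).

    What remains is the positivity of the symbol of qM. The integral
    recursion gives the truncated power formula for the cardinal spline
    ([cardinal_splineE]), from which its values at the integers satisfy the
    recurrence of the Eulerian numbers. So qM is, up to the factor 1 / (2p+1)!,
    an Eulerian polynomial ([qM_eulerian]). Eulerian polynomials are
    gamma-positive: they are combinations of the X ^ i * (1 + X) ^ (2p - 2i) with
    nonnegative coefficients ([eulerian_poly_gamma]). Each of these terms has the
    nonnegative quadratic form |(1 + X) ^ (p - i) g| ^ 2, and the term i = p,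
    whose coefficient is positive, contributes a positive multiple of |g| ^ 2
    ([qM_coercive]). *)

(** * Truncated powers and the cardinal spline *)

Definition truncated_power {R : realType} (k : nat) (u : R) : R :=
  if 0 <= u then u ^+ k else 0.

(** The (k+1)-st backward difference of the truncated power of degree k; it is
    k! times the cardinal spline. *)
Definition spline_sum {R : realType} (k : nat) (t : R) : R :=
  \sum_(i < k.+2)
    (-1) ^+ i * 'C(k.+1, i)%:R * truncated_power k (t - i%:R).

Lemma continuous_powB {R : realType} (k : nat) (u : R) :
  continuous (fun s : R => (u - s) ^+ k).
Proof.
move=> x; apply: (@cvg_comp _ _ _ (fun s => u - s) (fun s => s ^+ k)).
  by apply: cvgB; [exact: cvg_cst|exact: cvg_id].
exact: exprn_continuous.
Qed.

Lemma Rintegral_powB {R : realType} (k : nat) (u c : R) : 0 <= c ->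
  Rintegral lebesgue_measure `[0, c] (fun s : R => (u - s) ^+ k) =
  (u ^+ k.+1 - (u - c) ^+ k.+1) / k.+1%:R.
Proof.
rewrite le_eqVlt => /predU1P[<-|c0].
  by rewrite set_itv1 Rintegral_set1 subr0 subrr mul0r.
pose F : R -> R := - k.+1%:R^-1 *: (cst u - id) ^+ k.+1.
have FE x : F x = - k.+1%:R^-1 * (u - x) ^+ k.+1 by rewrite /F fctE.
have dF (x : R) : is_derive x 1 F ((u - x) ^+ k).
  apply: is_derive_eq; rewrite /GRing.scale/= sub0r !mulrN1 mulrNN mulrA.
  by rewrite mulVf ?mul1r// pnatr_eq0.
have cF x : F y @[y --> x] --> F x.
  by apply/differentiable_continuous/derivable1_diffP; exact: ex_derive.
rewrite /Rintegral (@continuous_FTC2 _ _ F)//=.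
- by rewrite !FE subr0; ring.
- by apply: continuous_subspaceT; exact: continuous_powB.
- split=> //.
  + by apply: cvg_at_right_filter; exact: cF.
  + by apply: cvg_at_left_filter; exact: cF.
- by move=> x _; rewrite derive1E derive_val.
Qed.

(** Writing the integrand as the restriction of a polynomial reduces its
    integral over [0, 1] to that of a polynomial over a smaller interval, and
    treats the discontinuous case k = 0 together with the others. *)
Lemma truncated_power_restrict {R : realType} (k : nat) (u : R) :
  (fun s => truncated_power k (u - s)) =
  (fun s => (u - s) ^+ k) \_ `]-oo, u].
Proof.
apply/funext => s; rewrite /truncated_power subr_ge0 patchE.
case: ifPn => [su|su]; first by rewrite mem_set//= in_itv/=.
by rewrite memNset//= in_itv/=; exact/negP.
Qed.

Lemma itv01_truncate {R : realType} (u : R) :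
  [set` `[0, 1]] `&` [set` `]-oo, u]] = [set` `[0, Num.min 1 u]] :> set R.
Proof.
apply/seteqP; split => x /=; rewrite !in_itv/= le_min.
  by move=> [/andP[-> ->] ->].
by move=> /andP[-> /andP[-> ->]].
Qed.

Lemma integrable_truncated_power {R : realType} (k : nat) (u : R) :
  lebesgue_measure.-integrable `[0, 1]
    (EFin \o (fun s : R => truncated_power k (u - s))).
Proof.
rewrite truncated_power_restrict -restrict_EFin.
apply/integrable_restrict => //=.
rewrite itv01_truncate.
apply: continuous_compact_integrable; first exact: segment_compact.
by apply: continuous_subspaceT; exact: continuous_powB.
Qed.

Lemma Rintegral_truncated_power {R : realType} (k : nat) (u : R) :
  Rintegral lebesgue_measure `[0, 1] (fun s : R => truncated_power k (u - s)) =
  (truncated_power k.+1 u - truncated_power k.+1 (u - 1)) / k.+1%:R.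
Proof.
rewrite truncated_power_restrict -Rintegral_mkcondr itv01_truncate.
rewrite /truncated_power subr_ge0.
have [u0|u0] := ltP u 0.
  rewrite set_itv_ge ?bnd_simp -?ltNge ?gt_min ?u0 ?orbT// Rintegral_set0.
  by rewrite leNgt (lt_trans u0)// subr0 mul0r.
rewrite Rintegral_powB ?le_min ?ler01//.
by case: (leP 1 u) => // _; rewrite subrr expr0n.
Qed.

Lemma Rintegral_lincomb {R : realType} {d : measure_display}
    {T : measurableType d} (mu : {measure set T -> \bar R}) (D : set T)
    (n : nat) (c : nat -> R) (f : nat -> T -> R) :
  measurable D -> (forall i, mu.-integrable D (EFin \o f i)) ->
  Rintegral mu D (fun s => \sum_(i < n) c i * f i s) =
  \sum_(i < n) c i * Rintegral mu D (f i).
Proof.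
move=> mD fi; have cfi i : mu.-integrable D (EFin \o (fun s => c i * f i s)).
  rewrite (_ : _ \o _ = (fun s => (c i)%:E * (EFin \o f i) s)%E); last first.
    by apply/funext => s /=; rewrite EFinM.
  exact: integrableZl.
elim: n => [|n IHn].
  rewrite big_ord0; under eq_Rintegral do rewrite big_ord0.
  by rewrite Rintegral_cst// mul0r.
rewrite big_ord_recr/= -IHn -RintegralZl//.
rewrite -RintegralD//; last first.
  rewrite (_ : _ \o _ = (fun s => \sum_(i < n) (c i * f i s)%R%:E)%E).
    by apply: integrable_sum => //= i _; exact: cfi.
  by apply/funext => s /=; rewrite sumEFin.
by apply: eq_Rintegral => s _; rewrite big_ord_recr.
Qed.

(** Pascal's rule: the (k+1)-st difference is the k-th difference of the first
    difference. *)
Lemma alt_bin_sum_diff {R : comRingType} (k : nat) (Y : nat -> R) :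
  \sum_(i < k.+1) (-1) ^+ i * 'C(k, i)%:R * (Y i - Y i.+1) =
  \sum_(i < k.+2) (-1) ^+ i * 'C(k.+1, i)%:R * Y i.
Proof.
under eq_bigr do rewrite mulrBr; rewrite sumrB.
rewrite [in RHS]big_ord_recl/= bin0.
have -> : \sum_(i < k.+1) (-1) ^+ i * 'C(k, i)%:R * Y i =
    Y 0 + \sum_(i < k.+1) (-1) ^+ i.+1 * 'C(k, i.+1)%:R * Y i.+1.
  have := @big_ord_recr _ 0 +%R k.+1
    (fun i : 'I_k.+2 => (-1) ^+ i * 'C(k, i)%:R * Y i : R).
  rewrite /= bin_small// mulr0 mul0r addr0 => <-.
  by rewrite big_ord_recl/= bin0 expr0 !mul1r.
rewrite expr0 !mul1r -addrA; congr (_ + _).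
rewrite -sumrB; apply: eq_bigr => i _.
by rewrite /bump/= add1n binS natrD exprS; ring.
Qed.

Lemma cardinal_splineE {R : realType} (k : nat) (t : R) :
  cardinal_spline k t = spline_sum k t / k`!%:R.
Proof.
rewrite /spline_sum; elim: k t => [|k IHk] t.
  rewrite /= indicE fact0 divr1 !big_ord_recl big_ord0/= /truncated_power.
  rewrite !expr0 subr0 bin0 bin1 /bump/= subr_ge0.
  rewrite expr1 !mulr1 !mul1r mulN1r addr0.
  have [t1|t1] := leP 1 t; have [t0|t0] := leP 0 t.
  - by rewrite memNset ?subrr//= in_itv/= t0 ltNge t1.
  - by have := le_lt_trans t1 t0; rewrite ltr10.
  - by rewrite mem_set ?subr0//= in_itv/= t0.
  - by rewrite memNset ?subr0//= in_itv/= leNgt t0.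
(* Each truncated power integrates to a difference of truncated powers of the
   next degree, and Pascal's rule collects these differences. *)
rewrite [LHS]/=; under eq_Rintegral => s _.
  rewrite IHk mulr_suml.
  under eq_bigr => i _ do rewrite mulrAC [t - s - _]addrAC.
  over.
rewrite (Rintegral_lincomb lebesgue_measure _ _
  (fun i => (-1) ^+ i * 'C(k.+1, i)%:R / k`!%:R)
  (fun i (s : R) => truncated_power k (t - i%:R - s))) //; last first.
  by move=> i; exact: integrable_truncated_power.
rewrite -(alt_bin_sum_diff k.+1 (fun i => truncated_power k.+1 (t - i%:R))).
rewrite mulr_suml; apply: eq_bigr => i _.
rewrite Rintegral_truncated_power factS natrM invfM -[i.+1%:R]natr1 opprD addrA.
by ring.
Qed.

(** * Eulerian polynomials *)

Lemma truncated_powerS {R : realType} (k : nat) (u : R) :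
  truncated_power k.+1 u = u * truncated_power k u.
Proof. by rewrite /truncated_power; case: ifP; rewrite ?exprS ?mulr0. Qed.

(** The terms cancel in pairs, since
    (i + 1) * C(k + 1, i + 1) = (k + 1 - i) * C(k + 1, i). *)
Lemma alt_bin_sum_weighted {R : comRingType} (k : nat) (X : nat -> R) :
  \sum_(i < k.+2) (-1) ^+ i * 'C(k.+1, i)%:R *
    (i%:R * X i + (k.+1%:R - i%:R) * X i.+1) = 0.
Proof.
under eq_bigr do rewrite mulrDr.
rewrite big_split/= big_ord_recl/= mul0r mulr0 add0r.
rewrite [X in _ + X]big_ord_recr/= subrr mul0r mulr0 addr0 -big_split/=.
rewrite big1// => i _; rewrite /bump/= add1n exprS.
have /(congr1 (fun n => n%:R : R)) := mul_bin_left k.+1 i.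
rewrite /= !natrM natrB; last by rewrite ltnW.
set x := X _; set a := (-1) ^+ i; set c := 'C(_, i.+1)%:R; set d := 'C(_, i)%:R => e.
transitivity (a * x * ((k.+1%:R - i%:R) * d - i.+1%:R * c)); first by ring.
by rewrite e subrr mulr0.
Qed.

(** The Cox-de Boor recurrence, up to the factor k!. Subtracting the two sides
    leaves the vanishing sum of [alt_bin_sum_weighted]. *)
Lemma spline_sumS {R : realType} (k : nat) (t : R) :
  spline_sum k.+1 t =
  t * spline_sum k t + (k.+2%:R - t) * spline_sum k (t - 1).
Proof.
rewrite /spline_sum -(alt_bin_sum_diff k.+1
  (fun i => truncated_power k.+1 (t - i%:R))).
apply/eqP; rewrite -subr_eq0 !mulr_sumr -big_split/= -sumrB.
have := alt_bin_sum_weighted k (fun i => truncated_power k (t - i%:R)).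
move/(congr1 (fun x => - x)); rewrite -sumrN oppr0 => /eqP; congr (_ == _).
apply: eq_bigr => i _.
rewrite !truncated_powerS -[k.+2%:R]natr1.
have -> : t - 1 - i%:R = t - i.+1%:R :> R by rewrite -natr1; ring.
by rewrite -[i.+1%:R]natr1; ring.
Qed.

(** The Eulerian polynomial of degree k, which belongs to permutations of k + 1
    letters. Its recursion is [spline_sumS] read on generating functions. *)
Fixpoint eulerian_poly (R : nzRingType) (k : nat) : {poly R} :=
  if k is k'.+1 then
    (1 - 'X) * ('X * eulerian_poly R k')^`() +
      k'.+2%:R *: ('X * eulerian_poly R k')
  else 1.

Lemma spline_sum_0 {R : realType} (k : nat) : spline_sum k.+1 (0 : R) = 0.
Proof.
rewrite /spline_sum big1// => i _; rewrite truncated_powerS sub0r.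
rewrite /truncated_power oppr_ge0 lern0; case: eqP => [->|_].
  by rewrite oppr0 mul0r mulr0.
by rewrite !mulr0.
Qed.

Lemma coef_eulerian_poly {R : realType} (k m : nat) :
  (eulerian_poly R k)`_m = spline_sum k.+1 m.+1%:R.
Proof.
elim: k m => [|k IHk] m.
  rewrite /= coef1 /spline_sum !big_ord_recl big_ord0 /= !truncated_powerS.
  rewrite /truncated_power /bump !expr0 !addn0 bin0 bin1 binn /=.
  have -> : 0 <= m.+1%:R - 0 :> R by rewrite subr0 ler0n.
  have -> : 0 <= m.+1%:R - 1%:R :> R by rewrite subr_ge0 ler_nat.
  case: m => [|m].
    by rewrite subr_ge0 ler_nat/= sqrrN; ring.
  by rewrite subr_ge0 ler_nat/= -[m.+2%:R]natr1 -[m.+1%:R]natr1 sqrrN; ring.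
rewrite spline_sumS /= mulrBl mul1r coefD coefB coefZ coefXM !coef_deriv !coefXM /=.
case: m => [|m].
  by rewrite subr0 subrr spline_sum_0 IHk !mulr0 !addr0 mul1r.
have -> : m.+2%:R - 1 = m.+1%:R :> R by rewrite -[m.+2%:R]natr1 addrK.
by rewrite -!IHk /=; ring.
Qed.

(** Coordinates of the Eulerian polynomial of degree k in the basis
    X ^ i * (1 + X) ^ (k - 2i); the recursion is [eulerian_step_gamma]. The
    subtraction on natural numbers makes the coordinates with k < 2i vanish,
    so that sums over i may range up to k. *)
Fixpoint gamma_coef (k i : nat) : nat :=
  if k is k'.+1 then
    i.+1 * gamma_coef k' i +
      (if i is i'.+1 then 2 * (k' - 2 * i') * gamma_coef k' i' else 0)
  else i == 0.

Lemma gamma_coef_small (k i : nat) : (k < 2 * i)%N -> gamma_coef k i = 0%N.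
Proof.
elim: k i => [|k IHk] [|i] ki //=; try by move: ki; rewrite muln0.
rewrite IHk; last lia.
have -> : (k - 2 * i = 0)%N by lia.
by rewrite !muln0 mul0n.
Qed.

Lemma gamma_coef_gt0 (k i : nat) : (2 * i <= k)%N -> (0 < gamma_coef k i)%N.
Proof.
elim: k i => [|k IHk] i /= ki; first by have -> : i = 0%N by lia.
have [ik|ik] := leqP (2 * i) k; first by rewrite ltn_addr// muln_gt0 IHk.
case: i ki ik => [|i] ki ik; first lia.
rewrite ltn_addl// !muln_gt0/= IHk; lia.
Qed.

Definition gamma_poly (R : nzRingType) (i d : nat) : {poly R} :=
  'X^i * (1 + 'X) ^+ d.

(** The step of the Eulerian recursion keeps the cone spanned by the gamma
    basis: collecting (1 - X) + 2X in one part and (1 - X) + (1 + X) in the other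
    leaves nonnegative coefficients only. *)
Lemma eulerian_step_gamma {R : comNzRingType} (i d : nat) :
  (1 - 'X) * ('X * gamma_poly R i d)^`() +
    (2 * i + d).+2%:R *: ('X * gamma_poly R i d) =
  i.+1%:R *: gamma_poly R i d.+1 + (2 * d)%:R *: gamma_poly R i.+1 d.-1.
Proof.
rewrite /gamma_poly mulrA -exprS derivM derivXn deriv_exp derivD derivX derivC.
rewrite -!mul_polyC !polyC_natr.
case: d => [|d]; rewrite /= !exprS; ring.
Qed.

Lemma eulerian_poly_gamma {R : comNzRingType} (k : nat) :
  eulerian_poly R k =
  \sum_(i < k.+1) (gamma_coef k i)%:R *: gamma_poly R i (k - 2 * i).
Proof.
elim: k => [|k IHk].
  by rewrite big_ord_recl big_ord0 /gamma_poly/= !expr0 mulr1 scale1r addr0.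
rewrite /= IHk mulr_sumr raddf_sum mulr_sumr scaler_sumr -big_split/=.
transitivity (\sum_(i < k.+1)
    ((i.+1 * gamma_coef k i)%:R *: gamma_poly R i (k.+1 - 2 * i) +
     (2 * (k - 2 * i) * gamma_coef k i)%:R *: gamma_poly R i.+1 (k.+1 - 2 * i.+1))).
  apply: eq_bigr => i _.
  (* For k < 2i the exponent k - 2i is truncated, but the coefficient is 0. *)
  have [ik|ik] := leqP (2 * i) k; last first.
    by rewrite gamma_coef_small// !muln0 !scale0r mulr0 raddf0 mulr0 scaler0 addr0.
  rewrite -scalerAr derivZ -scalerAr scalerA [k.+2%:R * _]mulrC -scalerA -scalerDr.
  rewrite [k in k.+2%:R](_ : _ = 2 * i + (k - 2 * i))%N; last lia.
  rewrite eulerian_step_gamma scalerDr !scalerA -!natrM.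
  rewrite ![(gamma_coef _ _ * _)%N]mulnC.
  by congr (_ *: gamma_poly R _ _ + _ *: gamma_poly R _ _); lia.
rewrite big_split/= [RHS](big_ord_recl k.+1)/=.
under [in RHS]eq_bigr => i _ do rewrite /bump/= add1n natrD scalerDl.
rewrite big_split/= addrA; congr (_ + _).
rewrite big_ord_recl/= addn0; congr (_ + _).
rewrite [RHS]big_ord_recr/= gamma_coef_small; last lia.
by rewrite muln0 scale0r addr0.
Qed.

Lemma coef_gamma_poly {R : nzRingType} (i d n : nat) :
  (gamma_poly R i d)`_n = (if (n < i)%N then 0 else 'C(d, n - i)%:R).
Proof.
rewrite /gamma_poly coefXnM; case: ifP => // _.
elim: d (n - i)%N => [|d IHd] m.
  by rewrite expr0 coef1; case: m.
rewrite exprS mulrDl mul1r coefD coefXM !IHd.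
by case: m => [|m]; rewrite ?addr0 ?bin0//= binS natrD.
Qed.

(** Every element X ^ i * (1 + X) ^ (2p - 2i) of the gamma basis is
    palindromic. *)
Lemma coef_eulerian_poly_sym {R : comNzRingType} (p j : nat) : (j <= p)%N ->
  (eulerian_poly R (2 * p))`_(p + j) = (eulerian_poly R (2 * p))`_(p - j).
Proof.
move=> jp; rewrite eulerian_poly_gamma !coef_sum; apply: eq_bigr => i _.
rewrite !coefZ !coef_gamma_poly.
have [ip|ip] := leqP i p; last first.
  by rewrite gamma_coef_small ?mul0r//; lia.
congr (_ * _).
have -> : (p + j < i)%N = false by lia.
have [ji|ji] := ltnP (p - j) i; first by rewrite bin_small//; lia.
rewrite -[in LHS]bin_sub; last lia.
by congr ('C(_, _)%:R); lia.
Qed.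

Lemma size_eulerian_poly {R : comNzRingType} (k : nat) :
  (size (eulerian_poly R k) <= k.+1)%N.
Proof.
apply/leq_sizeP => n kn; rewrite eulerian_poly_gamma coef_sum big1// => i _.
rewrite coefZ coef_gamma_poly; case: ifP => [|_]; first by rewrite mulr0.
have [ik|ik] := leqP (2 * i) k; last by rewrite gamma_coef_small ?mul0r.
by rewrite bin_small ?mulr0//; lia.
Qed.

Lemma palindromic_poly_sum {R : nzRingType} (p : nat) (f : {poly R}) :
    (size f <= (2 * p).+1)%N ->
    (forall j, (j <= p)%N -> f`_(p + j) = f`_(p - j)) ->
  f = f`_p *: 'X^p +
      \sum_(1 <= j < p.+1) f`_(p - j) *: ('X^(p + j) + 'X^(p - j)).
Proof.
move=> sf symf; apply/polyP => n.
rewrite coefD coefZ coefXn coef_sum.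
under eq_bigr do rewrite coefZ coefD !coefXn mulrDr.
have [np|np|->] := ltngtP n p.
- have jn : (p - n)%N \in index_iota 1 p.+1 by rewrite mem_index_iota; lia.
  rewrite mulr0 add0r (bigD1_seq _ jn (iota_uniq _ _))/=.
  rewrite big_nat_cond big1 => [|j /andP[jp nj]].
    have -> : (n == p + (p - n))%N = false by lia.
    have -> : (p - (p - n) = n)%N by lia.
    by rewrite eqxx mulr0 mulr1 add0r addr0.
  have -> : (n == p + j)%N = false by lia.
  have -> : (n == p - j)%N = false by lia.
  by rewrite mulr0 addr0.
- have [n2|n2] := leqP n (2 * p).
    have jn : (n - p)%N \in index_iota 1 p.+1 by rewrite mem_index_iota; lia.
    rewrite mulr0 add0r (bigD1_seq _ jn (iota_uniq _ _))/=.
    rewrite big_nat_cond big1 => [|j /andP[jp nj]].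
      have -> : (n == p + (n - p))%N by lia.
      have -> : (n == p - (n - p))%N = false by lia.
      rewrite -symf; last lia.
      by rewrite subnKC ?mulr0 ?mulr1 ?addr0// ltnW.
    have -> : (n == p + j)%N = false by lia.
    have -> : (n == p - j)%N = false by lia.
    by rewrite mulr0 addr0.
  rewrite mulr0 add0r nth_default; last by apply: leq_trans sf _.
  rewrite big_nat big1// => j jp.
  have -> : (n == p + j)%N = false by lia.
  have -> : (n == p - j)%N = false by lia.
  by rewrite mulr0 addr0.
- rewrite mulr1 big_nat big1 ?addr0// => j jp.
  have -> : (p == p + j)%N = false by lia.
  have -> : (p == p - j)%N = false by lia.
  by rewrite mulr0 addr0.
Qed.

(** * The scalar product of coefficients *)

Definition coef_dot {R : nzRingType} (f g : {poly R}) : R :=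
  \sum_(i < size f) f`_i * g`_i.

Lemma coef_dot_widen {R : nzRingType} (n : nat) (f g : {poly R}) :
  (size f <= n)%N -> coef_dot f g = \sum_(i < n) f`_i * g`_i.
Proof.
move=> fn; rewrite /coef_dot (big_ord_widen n (fun i => f`_i * g`_i) fn).
rewrite [LHS]big_mkcond/=; apply: eq_bigr => i _.
by case: ltnP => // fi; rewrite nth_default ?mul0r.
Qed.

Lemma coef_dotC {R : comNzRingType} (f g : {poly R}) :
  coef_dot f g = coef_dot g f.
Proof.
rewrite (coef_dot_widen (maxn (size f) (size g))) ?leq_maxl//.
rewrite [RHS](coef_dot_widen (maxn (size f) (size g))) ?leq_maxr//.
by apply: eq_bigr => i _; rewrite mulrC.
Qed.

Lemma coef_dotDr {R : nzRingType} (f g h : {poly R}) :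
  coef_dot f (g + h) = coef_dot f g + coef_dot f h.
Proof.
by rewrite -big_split/=; apply: eq_bigr => i _; rewrite coefD mulrDr.
Qed.

Lemma coef_dotZr {R : comNzRingType} (c : R) (f g : {poly R}) :
  coef_dot f (c *: g) = c * coef_dot f g.
Proof.
by rewrite mulr_sumr; apply: eq_bigr => i _; rewrite coefZ mulrCA.
Qed.

Lemma coef_dotNr {R : comNzRingType} (f g : {poly R}) :
  coef_dot f (- g) = - coef_dot f g.
Proof. by rewrite -scaleN1r coef_dotZr mulN1r. Qed.

Lemma coef_dotDl {R : comNzRingType} (f g h : {poly R}) :
  coef_dot (f + g) h = coef_dot f h + coef_dot g h.
Proof. by rewrite coef_dotC coef_dotDr ![coef_dot h _]coef_dotC. Qed.

Lemma coef_dotZl {R : comNzRingType} (c : R) (f g : {poly R}) :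
  coef_dot (c *: f) g = c * coef_dot f g.
Proof. by rewrite coef_dotC coef_dotZr coef_dotC. Qed.

Lemma coef_dotNl {R : comNzRingType} (f g : {poly R}) :
  coef_dot (- f) g = - coef_dot f g.
Proof. by rewrite coef_dotC coef_dotNr coef_dotC. Qed.

Lemma coef_dot0l {R : nzRingType} (g : {poly R}) : coef_dot 0 g = 0.
Proof. by rewrite /coef_dot size_poly0 big_ord0. Qed.

Lemma coef_dot_suml {R : comNzRingType} (I : Type) (r : seq I) (P : pred I)
    (F : I -> {poly R}) (g : {poly R}) :
  coef_dot (\sum_(i <- r | P i) F i) g = \sum_(i <- r | P i) coef_dot (F i) g.
Proof.
by apply: (big_morph (coef_dot^~ g)) => [f h|]; rewrite ?coef_dotDl ?coef_dot0l.
Qed.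

Lemma coef_dot_sumr {R : comNzRingType} (I : Type) (r : seq I) (P : pred I)
    (F : I -> {poly R}) (g : {poly R}) :
  coef_dot g (\sum_(i <- r | P i) F i) = \sum_(i <- r | P i) coef_dot g (F i).
Proof.
by rewrite coef_dotC coef_dot_suml; apply: eq_bigr => i _; rewrite coef_dotC.
Qed.

(** Multiplication by X ^ d is the right shift, an isometry; dropping the first
    d coefficients is its adjoint. *)
Lemma coef_dotXn {R : comNzRingType} (d : nat) (f g : {poly R}) :
  coef_dot f ('X^d * g) = coef_dot (drop_poly d f) g.
Proof.
rewrite (coef_dot_widen (d + size f)) ?leq_addl//.
rewrite [RHS](coef_dot_widen (size f)) ?size_drop_poly ?leq_subr//.
rewrite big_split_ord/= big1 ?add0r => [|i _].
  apply: eq_bigr => i _; rewrite coef_drop_poly coefXnM.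
  by rewrite ltnNge leq_addr/= addKn addnC.
by rewrite coefXnM ltn_ord mulr0.
Qed.

Lemma coef_dotXnXn {R : comNzRingType} (d : nat) (f g : {poly R}) :
  coef_dot ('X^d * f) ('X^d * g) = coef_dot f g.
Proof. by rewrite coef_dotXn mulrC drop_polyMXn_id. Qed.

Lemma coef_dotXn_adj {R : comNzRingType} (j d : nat) (f g : {poly R}) :
  (j <= d)%N -> coef_dot ('X^j * f) ('X^d * g) = coef_dot f ('X^(d - j) * g).
Proof.
by move=> jd; rewrite -{1}(subnKC jd) exprD -mulrA coef_dotXnXn.
Qed.

(** The adjoint of 1 + X is 1 + X ^ -1 = X ^ -1 * (1 + X). *)
Lemma coef_dot_addX_adj {R : comNzRingType} (d : nat) (f g : {poly R}) :
  coef_dot ((1 + 'X) ^+ d * f) ('X^d * g) = coef_dot f ((1 + 'X) ^+ d * g).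
Proof.
elim: d f g => [|d IHd] f g; first by rewrite !expr0 !mul1r.
rewrite exprSr -mulrA exprSr -mulrA IHd mulrCA.
have e h : coef_dot ((1 + 'X) * f) ('X * h) = coef_dot f ((1 + 'X) * h).
  rewrite !mulrDl !mul1r coef_dotDl coef_dotDr addrC.
  by rewrite -{1 2}['X]expr1 coef_dotXnXn.
by rewrite e; congr (coef_dot _ _); ring.
Qed.

Definition coef_sqn {R : nzRingType} (f : {poly R}) : R := coef_dot f f.

Lemma coef_sqn_ge0 {R : realDomainType} (f : {poly R}) : 0 <= coef_sqn f.
Proof. by apply: sumr_ge0 => i _; rewrite -expr2 sqr_ge0. Qed.

Lemma coef_sqr_le_sqn {R : realDomainType} (f : {poly R}) (i : nat) :
  f`_i ^+ 2 <= coef_sqn f.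
Proof.
have [fi|fi] := leqP (size f) i.
  by rewrite nth_default// expr0n coef_sqn_ge0.
rewrite /coef_sqn /coef_dot (bigD1 (Ordinal fi))//= expr2 lerDl.
by apply: sumr_ge0 => j _; rewrite -expr2 sqr_ge0.
Qed.

Lemma coef_sqnD {R : comNzRingType} (f g : {poly R}) :
  coef_sqn (f + g) = coef_sqn f + 2 * coef_dot f g + coef_sqn g.
Proof.
rewrite /coef_sqn coef_dotDl !coef_dotDr [coef_dot g f]coef_dotC; ring.
Qed.

Lemma coef_sqnZ {R : comNzRingType} (c : R) (f : {poly R}) :
  coef_sqn (c *: f) = c ^+ 2 * coef_sqn f.
Proof. by rewrite /coef_sqn coef_dotZl coef_dotZr mulrA expr2. Qed.

Lemma coef_sqnXnM {R : comNzRingType} (d : nat) (f : {poly R}) :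
  coef_sqn ('X^d * f) = coef_sqn f.
Proof. exact: coef_dotXnXn. Qed.

Lemma coef_sqn_drop {R : realDomainType} (d : nat) (f : {poly R}) :
  coef_sqn (drop_poly d f) <= coef_sqn f.
Proof.
have := coef_sqn_ge0 (f + (-1) *: ('X^d * drop_poly d f)).
rewrite coef_sqnD coef_dotZr coef_dotXn coef_sqnZ coef_sqnXnM.
rewrite -/(coef_sqn _); lra.
Qed.

Lemma coef_sqnM_bounded {R : realFieldType} (f : {poly R}) :
  exists2 C : R, 0 < C & forall g, coef_sqn (f * g) <= C * coef_sqn g.
Proof.
elim/poly_ind: f => [|f c [C C0 fC]].
  exists 1 => // g; rewrite mul0r /coef_sqn coef_dot0l mul1r.
  exact: coef_sqn_ge0.
exists (2 * C + 2 * c ^+ 2) => [|g].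
  by have := sqr_ge0 c; lra.
rewrite mulrDl mulrAC mul_polyC [f * g * 'X]mulrC -['X]expr1 coef_sqnD.
(* |u + v| ^ 2 <= 2 |u| ^ 2 + 2 |v| ^ 2 because |u - v| ^ 2 >= 0. *)
have := coef_sqn_ge0 ('X^1 * (f * g) + (-1) *: (c *: g)).
rewrite coef_sqnD coef_dotZr [coef_sqn (-1 *: _)]coef_sqnZ !coef_sqnZ coef_sqnXnM.
have := fC g; have := sqr_ge0 c; lra.
Qed.

(** Expand 0 <= |m g - c X ^ d g| ^ 2; this replaces the Cauchy-Schwarz
    inequality. *)
Lemma coercive_sqn {R : realFieldType} (c : R) (d : nat) (m g : {poly R}) :
    0 <= c -> c * coef_sqn g <= coef_dot (m * g) ('X^d * g) ->
  c ^+ 2 * coef_sqn g <= coef_sqn (m * g).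
Proof.
move=> c0 mg; have := coef_sqn_ge0 (m * g + (- c) *: ('X^d * g)).
rewrite coef_sqnD coef_dotZr coef_sqnZ coef_sqnXnM sqrrN.
have := ler_wpM2l c0 mg; rewrite mulrA -expr2; lra.
Qed.

(** On the unit circle X ^ (i - p) * (1 + X) ^ (2p - 2i) equals
    |1 + X| ^ (2p - 2i); this is the corresponding identity of quadratic
    forms. *)
Lemma coef_dot_gamma_poly {R : comNzRingType} (p i : nat) (g : {poly R}) :
  (i <= p)%N ->
  coef_dot (gamma_poly R i (2 * p - 2 * i) * g) ('X^p * g) =
  coef_sqn ((1 + 'X) ^+ (p - i) * g).
Proof.
move=> ip; rewrite /gamma_poly -mulrA coef_dotXn_adj//.
have -> : (2 * p - 2 * i = (p - i) + (p - i))%N by lia.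
by rewrite exprD -mulrA coef_dot_addX_adj.
Qed.

(** * Vector norms and operator norms *)

Lemma vec_norm_ge_entry {R : realType} (nu : norm_index) (n : nat)
    (x : 'cV[R]_n) (i : 'I_n) : `|x i 0| <= vec_norm nu x.
Proof.
case: nu => /=.
- by rewrite (bigD1 i)//= lerDl sumr_ge0.
- rewrite -[leLHS]ger0_norm// -sqrtr_sqr ler_wsqrtr//.
  by rewrite (bigD1 i)//= lerDl sumr_ge0// => j _; rewrite sqr_ge0.
- exact: le_bigmax.
Qed.

Lemma vec_norm_le_norm1 {R : realType} (nu : norm_index) (n : nat)
    (x : 'cV[R]_n) : vec_norm nu x <= vec_norm norm1 x.
Proof.
case: nu => //=.
- rewrite -[leRHS]ger0_norm ?sumr_ge0// -sqrtr_sqr ler_wsqrtr//.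
  suff [] : \sum_(i < n) `|x i 0| ^+ 2 <= (\sum_(i < n) `|x i 0|) ^+ 2 /\
      0 <= \sum_(i < n) `|x i 0| by [].
  elim/big_ind2 : _ => [|a b c d [ab b0] [cd d0]|i _]; rewrite ?expr0n//.
  by split; [have := mulr_ge0 b0 d0; nra|exact: addr_ge0].
- apply: bigmax_le => [|i _]; first by rewrite sumr_ge0.
  by rewrite (bigD1 i)//= lerDl sumr_ge0.
Qed.

(** The supremum that defines [op_norm] is over a bounded set: the entries of
    a vector in the unit ball are at most 1, so the sum of the absolute
    values of all entries of the matrix is a bound. *)
Lemma op_norm_ge {R : realType} (nu : norm_index) (n : nat) (A : 'M[R]_n)
    (x : 'cV[R]_n) : vec_norm nu x <= 1 -> vec_norm nu (A *m x) <= op_norm nu A.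
Proof.
move=> x1; apply: ub_le_sup; last by exists x.
exists (\sum_i \sum_j `|A i j|) => _ [y /= y1 <-].
apply: (le_trans (vec_norm_le_norm1 _ _ _)); apply: ler_sum => i _.
rewrite mxE (le_trans (ler_norm_sum _ _ _))//; apply: ler_sum => j _.
rewrite normrM ler_piMr// (le_trans _ y1)//; exact: vec_norm_ge_entry.
Qed.

Lemma op_norm_ge_entry {R : realType} (nu : norm_index) (n : nat) (A : 'M[R]_n)
    (i j : 'I_n) : `|A i j| <= op_norm nu A.
Proof.
have e1 : vec_norm nu (delta_mx j 0 : 'cV[R]_n) <= 1.
  apply: (le_trans (vec_norm_le_norm1 _ _ _)) => /=.
  rewrite (bigD1 j)//= big1 => [|k kj]; rewrite !mxE ?eqxx ?normr1 ?addr0//.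
  by rewrite (negPf kj)/= normr0.
apply: le_trans (op_norm_ge _ _ _ _ e1); rewrite -colE.
by apply: le_trans (vec_norm_ge_entry nu _ _ i); rewrite mxE.
Qed.

(** * Exponential decay beats polynomial growth *)

Lemma bernoulli_geometric {R : realFieldType} (mu delta : R) (K : nat) :
  0 <= mu -> 0 <= delta -> mu * (1 + delta) = 1 ->
  mu ^+ K * (1 + K%:R * delta) <= 1.
Proof.
move=> mu0 d0 mud; elim: K => [|K IHK]; first by rewrite expr0; lra.
apply: le_trans IHK; rewrite exprSr -mulrA ler_wpM2l ?exprn_ge0//.
have mu1 : mu <= 1 by rewrite -mud; have := mulr_ge0 mu0 d0; lra.
have : mu * (K%:R * delta) <= K%:R * delta.
  by rewrite ler_piMl// mulr_ge0.
rewrite -natr1; lra.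
Qed.

Lemma onem_exp_ge {R : realFieldType} (x : R) (N : nat) :
  0 <= x <= 1 -> 1 - N%:R * x <= (1 - x) ^+ N.
Proof.
move=> /andP[x0 x1]; elim: N => [|N IHN]; first by rewrite expr0; lra.
have : 0 <= 1 - x by lra.
move=> /ler_wpM2l /(_ _ _ IHN); rewrite -exprS; apply: le_trans.
rewrite -natr1; have : 0 <= N%:R * (x * x) by rewrite mulr_ge0// mulr_ge0.
lra.
Qed.

Lemma poly_times_geometric_small {R : realType} (N : nat) (lambda eta : R) :
  0 <= lambda < 1 -> 0 < eta ->
  exists K0 : nat, forall K, (K0 <= K)%N -> K%:R ^+ N * lambda ^+ K < eta.
Proof.
move=> /andP[l0 l1] eta0.
pose x := (1 - lambda) / (2 * N.+1%:R).
have N0 : 0 < 2 * N.+1%:R :> R by rewrite mulr_gt0.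
have x0 : 0 < x by rewrite divr_gt0//; lra.
have x1 : x <= 2^-1.
  rewrite ler_pdivrMr//; have : 1 <= N.+1%:R :> R by rewrite ler1n.
  lra.
(* The rate mu < 1 satisfies lambda <= mu ^ (N + 1) by Bernoulli's inequality.
   Then K * mu ^ K is bounded, and its power N + 1 bounds K times the quantity
   under study. *)
pose mu := 1 - x; pose delta := mu^-1 - 1.
have mu0 : 0 < mu by rewrite /mu; lra.
have d0 : 0 < delta by rewrite subr_gt0 invf_gt1// /mu; lra.
have lmu : lambda <= mu ^+ N.+1.
  apply: le_trans (onem_exp_ge _ _ _); last by apply/andP; split; lra.
  have -> : N.+1%:R * x = (1 - lambda) / 2.
    by rewrite /x; field; rewrite nat1r pnatr_eq0.
  lra.
have Kmu K : K%:R * mu ^+ K <= delta^-1.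
  have := bernoulli_geometric _ _ K (ltW mu0) (ltW d0).
  rewrite {1}/delta subrKC divff ?gt_eqF// => /(_ erefl) h.
  rewrite -[leRHS]mul1r ler_pdivlMr//.
  have := exprn_ge0 K (ltW mu0); lra.
exists (Num.truncn (delta^-1 ^+ N.+1 / eta)).+1 => K KK.
have K1 : delta^-1 ^+ N.+1 / eta < K%:R.
  apply: lt_le_trans (truncnS_gt _) _; by rewrite ler_nat.
have K0 : 0 < K%:R :> R by rewrite ltr0n (leq_trans _ KK).
rewrite -(ltr_pM2l K0) mulrA -exprS.
apply: (@le_lt_trans _ _ (delta^-1 ^+ N.+1)); last first.
  by rewrite -ltr_pdivrMr.
apply: (@le_trans _ _ ((K%:R * mu ^+ K) ^+ N.+1)); last first.
  by rewrite lerXn2r ?nnegrE// ?invr_ge0 ?(ltW d0)// mulr_ge0// exprn_ge0// ltW.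
rewrite exprMn ler_wpM2l ?exprn_ge0//.
by rewrite exprAC lerXn2r ?nnegrE// exprn_ge0// ltW.
Qed.

(** * Toeplitz matrices with a coercive but displaced symbol *)

(** The operator g |-> drop_poly d (q * g) is the semi-infinite Toeplitz
    operator with q`_d on the diagonal. The polynomial Y is the K-th Richardson
    iterate for the right-hand side 1, and [1 - b *: drop_poly d (q * Y)] is its
    residual. For an operator T with <T g, g> >= eps |g| ^ 2 and
    |T g| ^ 2 <= D |g| ^ 2, the choice b = eps / D gives
    |g - b T g| ^ 2 <= (1 - eps ^ 2 / D) |g| ^ 2, and
    (1 - eps ^ 2 / (2D)) ^ 2 is at least this factor. *)
Lemma toeplitz_richardson {R : realType} (q : {poly R}) (d : nat) (eps : R) :
    0 < eps ->
    (forall g, eps * coef_sqn g <= coef_dot (q * g) ('X^d * g)) ->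
  exists2 b : R, 0 < b & exists2 lambda : R, 0 < lambda < 1 &
    forall K : nat, exists2 Y : {poly R}, (size Y <= (size q * K).+1)%N &
      forall i, `|(1 - b *: drop_poly d (q * Y))`_i| <= lambda ^+ K.
Proof.
move=> eps0 coercive; have [C C0 qC] := coef_sqnM_bounded q.
(* Enlarging the bound C by eps ^ 2 makes eps ^ 2 / D <= 1, hence lambda > 0. *)
pose D := C + eps ^+ 2; pose b := eps / D; pose lambda := 1 - eps ^+ 2 / D / 2.
have e20 : 0 < eps ^+ 2 by rewrite exprn_gt0.
have D0 : 0 < D by rewrite addr_gt0.
have b0 : 0 < b by rewrite divr_gt0.
have x0 : 0 < eps ^+ 2 / D by rewrite divr_gt0.
have x1 : eps ^+ 2 / D <= 1 by rewrite ler_pdivrMr// mul1r lerDr ltW.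
exists b => //; exists lambda; first by rewrite /lambda; apply/andP; split; lra.
have lambda0 : 0 <= lambda by rewrite /lambda; lra.
pose T g := drop_poly d (q * g).
have contract g : coef_sqn (g - b *: T g) <= lambda ^+ 2 * coef_sqn g.
  have g0 := coef_sqn_ge0 g.
  rewrite -scaleNr coef_sqnD coef_dotZr coef_sqnZ sqrrN coef_dotC.
  have h1 : b * (eps * coef_sqn g) <= b * coef_dot (T g) g.
    by rewrite ler_pM2l//; have := coercive g; rewrite coef_dotXn.
  have h2 : b ^+ 2 * coef_sqn (T g) <= b ^+ 2 * (D * coef_sqn g).
    rewrite ler_wpM2l ?sqr_ge0// (le_trans (coef_sqn_drop _ _))//.
    by rewrite (le_trans (qC g))// ler_wpM2r// lerDl ltW.
  have e1 : b * (eps * coef_sqn g) = eps ^+ 2 / D * coef_sqn g.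
    by rewrite /b; ring.
  have e2 : b ^+ 2 * (D * coef_sqn g) = eps ^+ 2 / D * coef_sqn g.
    by rewrite /b; field; rewrite gt_eqF.
  have h3 : 0 <= (eps ^+ 2 / D / 2) ^+ 2 * coef_sqn g.
    by rewrite mulr_ge0 ?sqr_ge0.
  rewrite /lambda; lra.
suff iter K : exists2 Y : {poly R}, (size Y <= (size q * K).+1)%N &
    coef_sqn (1 - b *: T Y) <= (lambda ^+ K) ^+ 2.
  move=> K; have [Y sY YK] := iter K; exists Y => // i.
  rewrite -(@ler_pXn2r _ 2)// ?nnegrE ?exprn_ge0// real_normK ?num_real//.
  exact: le_trans (coef_sqr_le_sqn _ _) YK.
elim: K => [|K [Y sY YK]].
  exists 0; first by rewrite size_poly0.
  rewrite /T mulr0 linear0 scaler0 subr0 /coef_sqn /coef_dot size_poly1.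
  by rewrite big_ord1 coef1 mulr1 !expr0 expr1n.
exists (Y + (1 - b *: T Y)).
  rewrite (leq_trans (size_polyD _ _))// geq_max; apply/andP; split.
    by rewrite (leq_trans sY)// ltnS leq_mul2l leqnSn orbT.
  rewrite (leq_trans (size_polyD _ _))// geq_max size_poly1/= size_polyN.
  rewrite (leq_trans (size_scale_leq _ _))// size_drop_poly.
  rewrite (leq_trans (leq_subr _ _))// (leq_trans (size_polyMleq _ _))//.
  by rewrite (leq_trans (leq_pred _))// mulnS -addnS leq_add2l.
have -> : 1 - b *: T (Y + (1 - b *: T Y)) =
    (1 - b *: T Y) - b *: T (1 - b *: T Y).
  by rewrite /T mulrDr linearD scalerDr opprD addrA.
apply: le_trans (contract _) _; rewrite [lambda ^+ K.+1]exprS exprMn.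
by rewrite ler_wpM2l ?sqr_ge0.
Qed.

Definition shifted_toeplitz {R : nzRingType} (q : {poly R}) (c n : nat) :
    'M[R]_n :=
  \matrix_(r < n, s < n) if (r <= c + s)%N then q`_(c + s - r) else 0.

(** Reversing the order of the entries turns the matrix product, a correlation
    with the coefficients of q, into the convolution q * Y. *)
Lemma shifted_toeplitz_mul_rev {R : comNzRingType} (q Y : {poly R}) (c n : nat)
    (r : 'I_n) : (size Y <= n)%N ->
  (shifted_toeplitz q c n *m \col_(s < n) Y`_(n.-1 - s)) r 0 =
  (q * Y)`_(c + (n.-1 - r)).
Proof.
move=> sY; rewrite mxE (reindex_inj rev_ord_inj)/= coefMr.
pose N := (c + (n.-1 - r))%N; pose F j := q`_(N - j) * Y`_j.
rewrite (big_ord_widen (n + N.+1) F) ?leq_addl//.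
transitivity (\sum_(j < n) if (j <= N)%N then F j else 0).
  apply: eq_bigr => j _; rewrite !mxE /F /N.
  have jn := ltn_ord j; have rn := ltn_ord r.
  have -> : (r <= c + (n - j.+1))%N = (j <= c + (n.-1 - r))%N by lia.
  case: ifP => jN; last by rewrite mul0r.
  congr (q`_ _ * Y`_ _) => /=; lia.
rewrite (big_ord_widen (n + N.+1) (fun j => if (j <= N)%N then F j else 0)) //;
  last exact: leq_addr.
rewrite big_mkcond [RHS]big_mkcond/=; apply: eq_bigr => j _; rewrite ltnS.
case: ltnP => // nj; case: ifP => // _.
by rewrite /F [Y`_j]nth_default ?mulr0// (leq_trans sY).
Qed.


(** Apply the matrix A to the reversal of the Richardson iterate Y. Since e > 0,
    the entries of A x are coefficients of q * Y beyond the d-th one, so they are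
    part of the small residual, whereas the d-th coefficient is close to 1 / b
    and forces Y not to be small. *)
Lemma shifted_toeplitz_condition_number_ge {R : realType} (q : {poly R})
    (d e : nat) (eps : R) :
    (0 < e)%N -> 0 < eps ->
    (forall g, eps * coef_sqn g <= coef_dot (q * g) ('X^d * g)) ->
  exists2 L : R, 0 < L & exists2 lambda : R, 0 < lambda < 1 &
    forall (nu : norm_index) (K : nat), (e <= K)%N -> lambda ^+ K <= 2^-1 ->
      let n := (size q * K).+1 in
      shifted_toeplitz q (d + e) n \in unitmx ->
      eps <= L * condition_number nu (shifted_toeplitz q (d + e) n) *
        (n%:R * lambda ^+ K).
Proof.
move=> e0 eps0 coercive.
have qd : eps <= q`_d.
  have := coercive 1; rewrite coef_dotXn mulr1 coef_dotC /coef_sqn /coef_dot.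
  by rewrite size_poly1 !big_ord1 !coef1 !mul1r mulr1 coef_drop_poly.
have [b b0 [lambda lambda01 approx]] := toeplitz_richardson _ _ _ eps0 coercive.
pose l := \sum_(j < d.+1) `|q`_(d - j)|.
have l0 : 0 < l.
  rewrite /l big_ord_recl/= subn0 ltr_wpDr ?sumr_ge0// gtr0_norm; lra.
exists (2 * l); first by rewrite mulr_gt0.
exists lambda => // nu K eK lambdaK n; set A := shifted_toeplitz _ _ _ => uA.
have lambdaK0 : 0 < lambda ^+ K by rewrite exprn_gt0; case/andP: lambda01.
have q0 : (0 < size q)%N.
  by rewrite size_poly_gt0; apply: contraTneq qd => ->; rewrite coef0 -ltNge.
have en : (e < n)%N by rewrite ltnS (leq_trans eK)// leq_pmull.
have [Y sY resid] := approx K.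
have n0 : 0 < n%:R :> R by rewrite ltr0n.
(* With this scaling the image A x has 1-norm at most 1, so no division by its
   norm is needed, even if it vanishes. *)
pose t := b / (n%:R * lambda ^+ K).
have t0 : 0 < t by rewrite divr_gt0// mulr_gt0.
pose x : 'cV[R]_n := \col_(s < n) (t *: Y)`_(n.-1 - s).
have stY : (size (t *: Y) <= n)%N by rewrite (leq_trans (size_scale_leq _ _)).
have normA : eps <= op_norm nu A.
  apply: le_trans (op_norm_ge_entry nu _ A (Ordinal en) ord0).
  rewrite mxE/= addn0 leq_addl addnK.
  by rewrite (le_trans qd)// ler_norm.
have normAx : vec_norm nu (A *m x) <= 1.
  apply: (le_trans (vec_norm_le_norm1 _ _ _)) => /=.
  have -> : 1 = \sum_(r < n) (n%:R^-1 : R).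
    by rewrite sumr_const card_ord -[RHS]mulr_natl divff// gt_eqF.
  apply: ler_sum => r _; rewrite shifted_toeplitz_mul_rev//.
  have := resid (e + (n.-1 - r))%N.
  rewrite coefB coef1 coefZ coef_drop_poly addn_eq0 (gtn_eqF e0)/= sub0r normrN.
  rewrite normrM (gtr0_norm b0) -scalerAr coefZ normrM (gtr0_norm t0).
  rewrite [(e + _ + d)%N]addnC addnA -ler_pdivlMl// => h.
  apply: le_trans (ler_wpM2l (ltW t0) h) _.
  rewrite le_eqVlt /t; apply/orP; left; apply/eqP; field.
  by rewrite !gt_eqF.
have normx : vec_norm nu x <= op_norm nu (invmx A).
  by rewrite -[x in leLHS](mulKmx uA); exact: op_norm_ge.
have headY : t / (2 * b) <= l * vec_norm nu x.
  have qY0 : (2 * b)^-1 <= `|(q * Y)`_d|.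
    have := resid 0%N; rewrite coefB coef1 coefZ coef_drop_poly add0n/= => h.
    have : 2^-1 <= b * `|(q * Y)`_d|.
      rewrite -(gtr0_norm b0) -normrM.
      have := ler_normD (1 - b * (q * Y)`_d) (b * (q * Y)`_d).
      rewrite subrK normr1; lra.
    by rewrite -ler_pdivrMl// invfM mulrC.
  apply: (@le_trans _ _ (`|(q * (t *: Y))`_d|)).
    by rewrite -scalerAr coefZ normrM (gtr0_norm t0) ler_pM2l.
  rewrite coefMr (le_trans (ler_norm_sum _ _ _))// /l mulr_suml.
  apply: ler_sum => j _; rewrite normrM ler_wpM2l//.
  have [jn|jn] := ltnP j n; last first.
    rewrite [_`_j]nth_default ?(leq_trans stY)// normr0.
    by apply: le_trans (vec_norm_ge_entry nu _ x ord0).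
  apply: le_trans (vec_norm_ge_entry nu _ x (rev_ord (Ordinal jn))).
  by rewrite mxE/= subSS subKn.
have : (2 * (n%:R * lambda ^+ K))^-1 <= l * op_norm nu (invmx A).
  rewrite (le_trans _ (ler_wpM2l (ltW l0) normx))//.
  apply: le_trans headY; rewrite le_eqVlt /t; apply/orP; left; apply/eqP; field.
  by rewrite !gt_eqF.
have P0 : 0 < n%:R * lambda ^+ K by rewrite mulr_gt0.
rewrite -[_^-1]mulr1 ler_pdivrMl ?mulr_gt0// => h.
rewrite /condition_number; move: h normA.
move: (op_norm _ A) (op_norm _ (invmx A)) (_ * lambda ^+ K) P0 => oA oA' P P0 h h'.
have oA0 : 0 <= oA by lra.
apply: (le_trans h'); rewrite -[leLHS]mulr1.
apply: le_trans (ler_wpM2l oA0 h) _; lra.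
Qed.

Theorem shifted_toeplitz_not_weakly_well_conditioned {R : realType}
    (q : {poly R}) (d e : nat) (eps : R) (nu : norm_index) :
    (0 < e)%N -> 0 < eps ->
    (forall g, eps * coef_sqn g <= coef_dot (q * g) ('X^d * g)) ->
  ~ weakly_well_conditioned nu (shifted_toeplitz q (d + e)).
Proof.
have common_bound (a b c f g : nat) : exists K : nat,
    [/\ (a <= K)%N, (b <= K)%N, (c <= K)%N, (f <= K)%N & (g <= K)%N].
  by exists (a + b + c + f + g)%N; split; lia.
move=> e0 eps0 coercive [[N0 _ unitA] [alpha alpha0 /eqO_exP[k k0 [N1 _ bound]]]].
have [L L0 [lambda lambda01 cond]] :=
  shifted_toeplitz_condition_number_ge _ _ _ _ e0 eps0 coercive.
have /andP[lambda0 lambda1] := lambda01.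
pose N := (Num.truncn alpha).+1.
pose M : R := L * k * (size q).+1%:R ^+ N.+1.
have M0 : 0 < M by rewrite /M mulr_gt0 ?exprn_gt0// mulr_gt0.
have l01 : 0 <= lambda < 1 by rewrite ltW.
have half0 : 0 < 2^-1 :> R by rewrite invr_gt0.
have [K1 small1] := poly_times_geometric_small 0 _ _ l01 half0.
have [K2 small2] := poly_times_geometric_small N.+1 _ _ l01 (divr_gt0 eps0 M0).
have [K [eK K1K K2K N0K N1K]] := common_bound e K1 K2 N0 N1.
pose n := (size q * K).+1.
have lambdaK : lambda ^+ K <= 2^-1.
  by have := small1 K K1K; rewrite expr0 mul1r => /ltW.
have q0 : (0 < size q)%N.
  rewrite size_poly_gt0; apply/eqP => q0; have := coercive 1.
  rewrite q0 mul0r /coef_sqn /coef_dot size_poly0 size_poly1 big_ord0 big_ord1.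
  by rewrite coef1 !mulr1 leNgt eps0.
have Kn : (K < n)%N by rewrite ltnS leq_pmull.
have n0 : 0 < n%:R :> R by rewrite ltr0n.
have nK : n%:R <= (size q).+1%:R * K%:R :> R.
  rewrite -natrM ler_nat mulSn /n -[X in (X <= _)%N]add1n leq_add2r.
  exact: leq_trans e0 eK.
have := cond nu K _ lambdaK; rewrite -/n.
have Nn : (N0 <= n)%N := leq_trans N0K (ltnW Kn).
have Nn1 : (N1 <= n)%N := leq_trans N1K (ltnW Kn).
move=> /(_ eK (unitA _ Nn)); apply/negP; rewrite -ltNge.
have := small2 K K2K; rewrite ltr_pdivlMr// => small; apply: le_lt_trans small.
have kappa : condition_number nu (shifted_toeplitz q (d + e) n) <=
    k * n%:R ^+ N.
  apply: le_trans (ler_norm _) _; apply: (le_trans (bound n Nn1)).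
  rewrite ler_pM2l// ger0_norm ?powR_ge0// -powR_mulrn ?ler0n//.
  apply: ler_powR; first by rewrite ler1n.
  by rewrite ltW// truncnS_gt.
have lK0 : 0 <= lambda ^+ K by rewrite exprn_ge0// ltW.
apply: (@le_trans _ _ (L * (k * n%:R ^+ N) * (n%:R * lambda ^+ K))).
  rewrite ler_wpM2r ?mulr_ge0//.
  by rewrite ler_pM2l.
apply: (@le_trans _ _ (L * k * n%:R ^+ N.+1 * lambda ^+ K)).
  by rewrite le_eqVlt exprS; apply/orP; left; apply/eqP; ring.
apply: (@le_trans _ _ (L * k * ((size q).+1%:R * K%:R) ^+ N.+1 * lambda ^+ K)).
  rewrite ler_wpM2r// ler_pM2l ?mulr_gt0// lerXn2r// nnegrE; first exact: ltW.
  by rewrite mulr_ge0.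
by rewrite le_eqVlt exprMn /M; apply/orP; left; apply/eqP; ring.
Qed.

(** * The mass and advection symbols *)

Lemma qM_eulerian {R : realType} (p : nat) :
  qM R p = ((2 * p).+1`!%:R)^-1 *: eulerian_poly R (2 * p).
Proof.
have spl i : (i <= p)%N -> cardinal_spline (2 * p).+1 ((p.+1 - i)%:R : R) =
    ((2 * p).+1`!%:R)^-1 * (eulerian_poly R (2 * p))`_(p - i).
  by move=> ip; rewrite cardinal_splineE coef_eulerian_poly subSn// mulrC.
rewrite [in RHS](palindromic_poly_sum p (eulerian_poly R (2 * p))).
- rewrite scalerDr scalerA -[X in _`_X]subn0 -spl// subn0 scaler_sumr.
  congr (_ + _); apply: eq_big_nat => j /andP[_ jp].
  by rewrite scalerA spl.
- exact: size_eulerian_poly.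
- by move=> j; exact: coef_eulerian_poly_sym.
Qed.

(** All terms of the gamma expansion have nonnegative quadratic forms; the
    middle one, i = p, is a positive multiple of X ^ p. *)
Lemma qM_coercive {R : realType} (p : nat) :
  exists2 c : R, 0 < c &
    forall g, c * coef_sqn g <= coef_dot (qM R p * g) ('X^p * g).
Proof.
exists (((2 * p).+1`!%:R)^-1 * (gamma_coef (2 * p) p)%:R) => [|g].
  by rewrite mulr_gt0 ?invr_gt0 ?ltr0n ?fact_gt0 ?gamma_coef_gt0.
rewrite qM_eulerian -[X in coef_dot X _]scalerAl coef_dotZl -mulrA.
rewrite ler_wpM2l ?invr_ge0//.
rewrite eulerian_poly_gamma mulr_suml coef_dot_suml.
have pp : (p < (2 * p).+1)%N by lia.
rewrite (bigD1 (Ordinal pp))//= -scalerAl coef_dotZl coef_dot_gamma_poly//.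
rewrite subnn expr0 mul1r lerDl sumr_ge0// => i _.
rewrite -scalerAl coef_dotZl; have [ip|ip] := leqP i p.
  by rewrite coef_dot_gamma_poly// mulr_ge0// coef_sqn_ge0.
by rewrite gamma_coef_small ?mul0r//; lia.
Qed.

Lemma qM_self_adjoint {R : realType} (p : nat) (f g : {poly R}) :
  coef_dot (qM R p * f) ('X^(2 * p) * g) = coef_dot f (qM R p * g).
Proof.
rewrite /qM !mulrDl coef_dotDl coef_dotDr -!scalerAl coef_dotZl coef_dotZr.
rewrite coef_dotXn_adj; last lia.
have -> : (2 * p - p = p)%N by lia.
congr (_ + _); rewrite !mulr_suml coef_dot_suml coef_dot_sumr.
apply: eq_big_nat => j /andP[_ jp].
rewrite -!scalerAl coef_dotZl coef_dotZr !mulrDl coef_dotDl coef_dotDr.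
rewrite !coef_dotXn_adj; try lia.
have -> : (2 * p - (p + j) = p - j)%N by lia.
have -> : (2 * p - (p - j) = p + j)%N by lia.
by rewrite addrC.
Qed.

Lemma qC_skew_adjoint {R : realType} (p : nat) (f g : {poly R}) :
  coef_dot (qC R p * f) ('X^(2 * p) * g) = - coef_dot f (qC R p * g).
Proof.
rewrite /qC !mulr_suml coef_dot_suml coef_dot_sumr -sumrN.
apply: eq_big_nat => j /andP[_ jp].
rewrite -!scalerAl coef_dotZl coef_dotZr -mulrN; congr (_ * _).
rewrite !mulrDl !mulNr coef_dotDl coef_dotDr !coef_dotNl !coef_dotNr.
rewrite !coef_dotXn_adj; try lia.
have -> : (2 * p - (p + j) = p - j)%N by lia.
have -> : (2 * p - (p - j) = p + j)%N by lia.
by rewrite opprD opprK addrC.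
Qed.

(** The quadratic form equals rho |qM g| ^ 2 - |qC g| ^ 2, because one factor qM
    moves to the other side unchanged and one factor qC with a minus sign. *)
Lemma Wtilde_coercive {R : realType} (p : nat) (c C rho : R) :
    0 < c -> 0 <= rho ->
    (forall g, c * coef_sqn g <= coef_dot (qM R p * g) ('X^p * g)) ->
    (forall g, coef_sqn (qC R p * g) <= C * coef_sqn g) ->
  forall g, (rho * c ^+ 2 - C) * coef_sqn g <=
    coef_dot ((rho *: qM R p ^+ 2 + qC R p ^+ 2) * g) ('X^(2 * p) * g).
Proof.
move=> c0 rho0 qMc qCC g.
rewrite [X in coef_dot X _]mulrDl coef_dotDl -[X in coef_dot X _ + _]scalerAl.
rewrite coef_dotZl [qM R p ^+ 2]expr2 [qC R p ^+ 2]expr2.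
rewrite -(mulrA (qM R p)) -(mulrA (qC R p)).
rewrite qM_self_adjoint qC_skew_adjoint mulrBl -mulrA.
have /(ler_wpM2l rho0) := coercive_sqn _ _ _ _ (ltW c0) (qMc g).
have := qCC g; rewrite /coef_sqn expr2; lra.
Qed.

Theorem proposition4p5 (R : realType) (p : nat) (hp : (1 <= p)%N) :
  exists2 rho_p : R, 0 < rho_p &
    forall rho : R, rho_p < rho ->
      forall nu : norm_index, ~ weakly_well_conditioned nu (Wtilde p rho).
Proof.
have [c c0 qMc] := @qM_coercive R p.
have [C C0 qCC] := coef_sqnM_bounded (qC R p).
exists (C / c ^+ 2); first by rewrite divr_gt0// exprn_gt0.
move=> rho rhoC nu.
have rho0 : 0 < rho by apply: lt_trans rhoC; rewrite divr_gt0// exprn_gt0.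
apply: (shifted_toeplitz_not_weakly_well_conditioned
  (rho *: qM R p ^+ 2 + qC R p ^+ 2) (2 * p) 2 (rho * c ^+ 2 - C)) => //.
  by rewrite subr_gt0 -ltr_pdivrMr// exprn_gt0.
by apply: Wtilde_coercive => //; exact: ltW.
Qed.
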